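(* Let $\sigma=(\sigma_j)_{j\in\mathbb N}\in\ell_2$ be a non-increasing sequence of non-negative real numbers, let $\varepsilon\in(0,1)$, and let $n,k\in\mathbb N$ be such that $$\sum_{j>k}\sigma_j^2\ \ge\ \frac{3n\sigma_k^2}{\varepsilon^2}.$$ Then with probability at least $1-5\exp(-n/64)$ it holds that $$\mathcal R_n(\sigma)\ \ge\ \mathcal R_n^{(1)}(\sigma)\ \ge\ \sigma_k(1-\varepsilon).$$
   Context: Convention: $a/0=\infty$ for $a>0$ and $0/0=0$. Put $H_\sigma=\{x\in\ell_2:\sum_{j\in\mathbb N}(x_j/\sigma_j)^2<\infty\}$ and $\mathcal E_\sigma=\{x\in\ell_2:\sum_{j\in\mathbb N}(x_j/\sigma_j)^2\le 1\}$. $G_n=(g_{ij})_{1\le i\le n,\,j\in\mathbb N}$ is a random matrix with independent standard Gaussian entries, and $G_nx=(\sum_{j}g_{ij}x_j)_{i=1}^n$, where a component is assigned the value NaN if its series does not converge (for $\sigma\in\ell_2$, almost surely all these series converge for all $x\in H_\sigma$). The radius of random information is $$\mathcal R_n(\sigma)=\inf_{\phi}\ \sup_{x\in\mathcal E_\sigma}\|\phi(G_nx)-x\|_2,$$ the infimum being over all mappings $\phi$ from the image of $G_n$ (on $H_\sigma$) to $\ell_2$. Moreover, $$\mathcal R_n^{(1)}(\sigma)=\sup\{x_1: x\in\mathcal E_\sigma,\ G_nx=0\},$$ where $G_nx=0$ includes the requirement that all the series $\sum_j g_{ij}x_j$, $i\le n$, converge. *)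

(* Defs.v *)
From HB Require Import structures.
From mathcomp Require Export all_boot all_order all_algebra.
From mathcomp Require Export all_classical all_reals all_analysis.
Export Order.TTheory GRing.Theory Num.Theory numFieldNormedType.Exports.

Set Implicit Arguments.
Unset Strict Implicit.
Unset Printing Implicit Defensive.

Local Open Scope classical_set_scope.
Local Open Scope ring_scope.

(** Sequences are numbered from 0: the coordinate x_j, j = 1, 2, ..., of the
    mathematical text is [x j.-1]; in particular x_1 is [x 0%N]. *)

Section RadiusOfInformation.
Context {R : realType}.

Definition l2norm (x : R^nat) : \bar R := 'N[counting]_2%:E[EFin \o x]%E.

Definition ell2 : set R^nat := [set x | (l2norm x < +oo)%E].

(** The division is that of [\bar R], in which 0^-1 = +oo and 0 * +oo = 0, so
    that a / 0 = +oo for a > 0 and 0 / 0 = 0; for a < 0 the quotient a / 0 is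
    -oo, whose square is +oo. *)
Definition weighted_sqsum (sigma x : R^nat) : \bar R :=
  (\sum_(0 <= j <oo) ((x j)%:E / (sigma j)%:E) ^+ 2)%E.

Definition Hspace (sigma : R^nat) : set R^nat :=
  [set x | ell2 x /\ (weighted_sqsum sigma x < +oo)%E].

Definition ellipsoid (sigma : R^nat) : set R^nat :=
  [set x | ell2 x /\ (weighted_sqsum sigma x <= 1)%E].

(** [None] plays the role of NaN. *)
Definition series_value (u : R^nat) : option R :=
  if `[< cvgn (series u) >] then Some (limn (series u)) else None.

Definition info n (G : 'I_n -> R^nat) (x : R^nat) : {ffun 'I_n -> option R} :=
  [ffun i => series_value (fun j => G i j * x j)].

(** A map from the image of [H_sigma] to l_2 is a total function satisfying
    [set_fun]; its values off that image are irrelevant, as the ellipsoid is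
    contained in [H_sigma]. *)
Definition radius n (sigma : R^nat) (G : 'I_n -> R^nat) : \bar R :=
  ereal_inf [set ereal_sup [set l2norm (phi (info G x) \- x) |
                            x in ellipsoid sigma] |
             phi in [set phi | set_fun (info G @` Hspace sigma) ell2 phi]].

Definition radius1 n (sigma : R^nat) (G : 'I_n -> R^nat) : \bar R :=
  ereal_sup [set (x 0%N)%:E |
             x in [set x | ellipsoid sigma x /\ info G x = [ffun=> Some 0]]].

End RadiusOfInformation.

Section GaussianMatrix.
Context {d : measure_display} {T : measurableType d} {R : realType}.
Variable P : probability T R.

Definition mutually_independent (I : eqType) (X : I -> {RV P >-> R}) : Prop :=
  forall (J : seq I) (B : I -> set R), uniq J ->
    (forall i, measurable (B i)) ->
    P (\bigcap_(i in [set` J]) X i @^-1` B i) =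
    (\prod_(i <- J) P (X i @^-1` B i))%E.

Definition standard_gaussian (X : {RV P >-> R}) : Prop :=
  forall B : set R, measurable B -> distribution P X B = normal_prob 0 1 B.

Definition gaussian_matrix n (g : 'I_n -> nat -> {RV P >-> R}) : Prop :=
  (forall i j, standard_gaussian (g i j)) /\
  mutually_independent (fun ij : 'I_n * nat => g ij.1 ij.2).

End GaussianMatrix.

(* Main.v *)
From HB Require Import structures.
Require Import Defs.
From mathcomp Require Import measurable_realfun ring lra zify.

(** The vectors [x] and [- x] of the kernel carry the same information, whence
    R_n^(1) <= R_n. For the lower bound on R_n^(1), let [b] be column 0 of the
    Gaussian matrix and let [A] have the columns sigma_j g_j for j in a window
    k < j <= k + N that carries 2.9/3 of the required tail. If A A^T >= kappa S
    with S the sum of the sigma_j^2 over the window, then A y = - b has a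
    solution with |y|^2 <= |b|^2 / (kappa S). Then x_0 = sigma_k (1 - eps) and
    x_j = x_0 sigma_j y_j define a kernel vector, which lies in the ellipsoid
    when |b|^2 <= 3n/2 and kappa = (15/29) eps (1 - eps)^2 / (2 - eps).

    The bound on A A^T is a union bound over lattice points of small l1-norm. A
    unit vector u with |A^T u|^2 < kappa S is rounded to the lattice one
    coordinate at a time, at a cost controlled by the Frobenius norm of A alone.
    For a fixed lattice point z, a Chernoff bound for |A^T z|^2 uses the identity
    E exp(- l (x + v g)^2) = (1 + 2 l v^2)^(-1/2) exp(- l x^2 / (1 + 2 l v^2)),
    applied to one Gaussian entry after the other: each is independent of the
    sigma-algebra generated by the remaining ones. The slack in the hypothesis
    lets these crude bounds beat the (53 e)^n lattice points for every eps. *)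

Set Implicit Arguments.
Unset Strict Implicit.
Unset Printing Implicit Defensive.
Local Open Scope classical_set_scope.
Local Open Scope ring_scope.

(** * Least norm solutions and lattice rounding *)

Section LinearAlgebra.
Context {R : realType}.

Definition sqn n (v : 'rV[R]_n) : R := \sum_j v 0 j ^+ 2.

Lemma sqn_ge0 n (v : 'rV[R]_n) : 0 <= sqn v.
Proof. by apply: sumr_ge0 => j _; exact: sqr_ge0. Qed.

Lemma sqn_eq0 n (v : 'rV[R]_n) : sqn v = 0 -> v = 0.
Proof.
move=> /eqP; rewrite psumr_eq0 => [|j _]; last exact: sqr_ge0.
move=> /allP v0; apply/rowP => j; rewrite mxE; apply/eqP.
by have := v0 j (mem_index_enum _); rewrite sqrf_eq0.
Qed.

Lemma sqnE n (v : 'rV[R]_n) : sqn v = (v *m v^T) 0 0.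
Proof. by rewrite mxE; apply: eq_bigr => j _; rewrite mxE expr2. Qed.

Lemma sqnZ n c (v : 'rV[R]_n) : sqn (c *: v) = c ^+ 2 * sqn v.
Proof. by rewrite mulr_sumr; apply: eq_bigr => j _; rewrite mxE exprMn. Qed.

(** The bound makes [H = A A^T] invertible, so with [w = b H^-1] the vector [y = w A] solves the
    system. It satisfies [|y|^2 = <b, w>] and [kappa |w|^2 <= |y|^2]. *)
Lemma solve_min_norm n N (A : 'M[R]_(n, N)) (b : 'rV[R]_n) (kappa : R) :
  0 < kappa -> (forall v, kappa * sqn v <= sqn (v *m A)) ->
  exists2 y : 'rV[R]_N, y *m A^T = b & sqn y <= sqn b / kappa.
Proof.
move=> k0 kA; pose H := A *m A^T.
have sqH v : sqn (v *m A) = (v *m H *m v^T) 0 0.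
  by rewrite sqnE trmx_mul /H !mulmxA.
have Hu : H \in unitmx.
  rewrite -row_free_unit; apply/inj_row_free => v vH.
  apply: sqn_eq0; apply/le_anti; rewrite sqn_ge0 andbT.
  have := kA v; rewrite sqH vH mul0mx mxE => h.
  by rewrite -(pmulr_rle0 _ k0).
pose w := b *m invmx H.
have yb : w *m A *m A^T = b by rewrite -mulmxA -/H /w mulmxKV.
exists (w *m A) => //.
have e : sqn (w *m A) = \sum_j b 0 j * w 0 j.
  by rewrite sqH /w mulmxKV// mxE; apply: eq_bigr => j _; rewrite [in LHS]mxE.
(* AM-GM: 2 <b, w> <= |b|^2 / kappa + kappa |w|^2 *)
have : 2 * sqn (w *m A) <= sqn b / kappa + kappa * sqn w.
  rewrite e !mulr_sumr mulr_suml -big_split/=; apply: ler_sum => j _.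
  have -> : b 0 j ^+ 2 / kappa + kappa * w 0 j ^+ 2 =
    2 * (b 0 j * w 0 j) + (b 0 j - kappa * w 0 j) ^+ 2 / kappa.
    by field; rewrite gt_eqF.
  by rewrite lerDl divr_ge0 ?sqr_ge0// ltW.
have := kA w; lra.
Qed.

Lemma sqn_rank1_update n N (A : 'M[R]_(n, N)) (v : 'rV[R]_n) i s :
  sqn ((v + s *: delta_mx 0 i) *m A) = sqn (v *m A) +
    s * (2 * \sum_j (v *m A) 0 j * A i j) + s ^+ 2 * \sum_j A i j ^+ 2.
Proof.
rewrite mulmxDl -scalemxAl -rowE !mulr_sumr -!big_split/=.
by apply: eq_bigr => j _; rewrite !mxE; ring.
Qed.

Lemma sqn_update n (v : 'rV[R]_n) i s :
  sqn (v + s *: delta_mx 0 i) = sqn v + s * (2 * v 0 i) + s ^+ 2.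
Proof.
have := sqn_rank1_update 1%:M v i s; rewrite !mulmx1 => ->; congr (_ + s * (2 * _) + _).
  rewrite (bigD1 i)//= mxE eqxx mulr1 big1 ?addr0// => j ji.
  by rewrite mxE eq_sym (negbTE ji) mulr0.
rewrite (bigD1 i)//= mxE eqxx expr1n big1 ?addr0 ?mulr1// => j ji.
by rewrite mxE eq_sym (negbTE ji) expr0n.
Qed.

(* Derandomized rounding of the real [x] to the grid [delta * Z]: rounding up or down at
   random with mean [x] gives a variance at most [delta ^+ 2 / 4], and one of the
   two values does not exceed the mean. *)
Lemma round_quadratic (delta x L q B : R) : 0 < delta -> q <= B -> 0 <= B ->
  exists2 z : int, `|delta * z%:~R - x| <= delta &
   (delta * z%:~R - x) * L + (delta * z%:~R - x) ^+ 2 * q <= delta ^+ 2 / 4 * B.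
Proof.
move=> d0 qB B0; pose m := Num.floor (x / delta).
pose p := x - delta * m%:~R.
have p0 : 0 <= p.
  by rewrite subr_ge0 mulrC -ler_pdivlMr//; exact: Num.Theory.floor_le.
have p1 : p <= delta.
  have /ltW := Num.Theory.floorD1_gt (x / delta); rewrite -/m ler_pdivrMr// intrD.
  rewrite /p; lra.
have [h|h] := lerP (- p * L + p ^+ 2 * q) (delta ^+ 2 / 4 * B).
  exists m; have -> : delta * m%:~R - x = - p by rewrite /p opprB.
    by rewrite normrN ger0_norm.
  by rewrite sqrrN.
have e : delta * (m + 1)%:~R - x = delta - p by rewrite intrD /p; ring.
exists (m + 1)%R; rewrite e; first by rewrite ger0_norm ?subr_ge0// gerBl.
have pd : 0 <= p * (delta - p) by rewrite mulr_ge0// subr_ge0.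
have pq : p * (delta - p) * q <= p * (delta - p) * B by exact: ler_wpM2l.
have pB : p * (delta - p) * B <= delta ^+ 2 / 4 * B.
  apply: ler_wpM2r => //; rewrite -subr_ge0.
  have -> : delta ^+ 2 / 4 - p * (delta - p) = (delta / 2 - p) ^+ 2 by field.
  exact: sqr_ge0.
(* If both roundings failed, so would their average with weights [delta - p] and [p]; but there the
   terms in [L] cancel, and [p * (delta - p) <= delta ^+ 2 / 4]. *)
rewrite leNgt; apply/negP => h2.
have : delta * (delta ^+ 2 / 4 * B) <
  (delta - p) * (- p * L + p ^+ 2 * q) +
  p * ((delta - p) * L + (delta - p) ^+ 2 * q).
  have [p00|p00] := eqVneq p 0; first by move: h; rewrite p00; nra.
  have pp : 0 < p by rewrite lt_neqAle eq_sym p00.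
  have a1 : (delta - p) * (delta ^+ 2 / 4 * B) <= (delta - p) * (- p * L + p ^+ 2 * q).
    by apply: ler_wpM2l; [rewrite subr_ge0|exact: ltW].
  have a2 : p * (delta ^+ 2 / 4 * B) < p * ((delta - p) * L + (delta - p) ^+ 2 * q).
    by rewrite ltr_pM2l.
  lra.
have -> : (delta - p) * (- p * L + p ^+ 2 * q) +
  p * ((delta - p) * L + (delta - p) ^+ 2 * q) = delta * (p * (delta - p) * q) by ring.
rewrite ltr_pM2l//; lra.
Qed.

(** Coordinates are rounded one after the other. The functional [|v A|^2 - C |v|^2] is quadratic in
    each of them, with leading coefficient at most the squared norm of that row of [A]. Tracking the
    difference avoids a separate estimate of the norm of the rounded vector. *)
Lemma round_grid n N (A : 'M[R]_(n, N)) (u : 'rV[R]_n) (delta C : R) :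
  0 < delta -> 0 <= C ->
  exists2 z : 'I_n -> int, (forall i, `|delta * (z i)%:~R - u 0 i| <= delta) &
    forall v : 'rV[R]_n, (forall i, v 0 i = delta * (z i)%:~R) ->
    sqn (v *m A) - C * sqn v <= sqn (u *m A) - C * sqn u +
      delta ^+ 2 / 4 * \sum_i \sum_j A i j ^+ 2.
Proof.
move=> d0 C0.
have H (s : seq 'I_n) : uniq s -> exists v : 'rV[R]_n,
  [/\ forall i, i \in s -> exists2 z : int, v 0 i = delta * z%:~R &
                                          `|v 0 i - u 0 i| <= delta,
      forall i, i \notin s -> v 0 i = u 0 i &
      sqn (v *m A) - C * sqn v <= sqn (u *m A) - C * sqn u +
        delta ^+ 2 / 4 * \sum_(i <- s) \sum_j A i j ^+ 2].
  elim: s => [_|i s ih /=/andP[si us]].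
    by exists u; split => //; rewrite big_nil mulr0 addr0.
  have [v [vs vns vQ]] := ih us.
  pose L := 2 * \sum_j (v *m A) 0 j * A i j - C * (2 * v 0 i).
  have B0 : 0 <= \sum_j A i j ^+ 2 by apply: sumr_ge0 => j _; exact: sqr_ge0.
  have [|t] := @round_quadratic delta (u 0 i) L
    (\sum_j A i j ^+ 2 - C) _ d0 _ B0; first by rewrite gerBl.
  set r := delta * _ - _ => rd rQ.
  have vE j : (v + r *: delta_mx 0 i) 0 j = if j == i then delta * t%:~R else v 0 j.
    rewrite !mxE eqxx/=; case: eqVneq => [->/=|_ /=]; last by rewrite mulr0 addr0.
    by rewrite mulr1 vns// addrC subrK.
  exists (v + r *: delta_mx 0 i); split => [j|j|].
  - rewrite inE vE; case: eqVneq => [-> _|_ /= js]; last exact: vs.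
    by exists t.
  - by rewrite inE vE; case: eqVneq => //= _; exact: vns.
  - rewrite big_cons sqn_rank1_update sqn_update.
    move: rQ; rewrite /L => rQ; lra.
have [v [vs _ vQ]] := H _ (index_enum_uniq _).
have /fin_all_exists2[z vz zd] : forall i : 'I_n, exists2 z : int,
    v 0 i = delta * z%:~R & `|v 0 i - u 0 i| <= delta.
  by move=> i; apply: vs; exact: mem_index_enum.
exists z => [i|v' v'z]; first by rewrite -vz.
by have -> : v' = v by apply/rowP => i; rewrite v'z vz.
Qed.

End LinearAlgebra.

(** * Lattice points of small l1-norm as a net *)

Section Net.
Context {R : realType}.

Lemma sum_geometric_le (q : R) m : 0 <= q < 1 -> \sum_(i < m) q ^+ i <= (1 - q)^-1.
Proof.
move=> /andP[q0 q1]; have p : 0 < 1 - q by rewrite subr_gt0.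
rewrite -[leRHS]mul1r ler_pdivlMr// mulrC -opprB mulNr -subrX1 opprB.
by rewrite gerBl exprn_ge0.
Qed.

(** The shift by [M] places integer vectors with entries between [- M] and [M] in a finite type. *)
Definition l1_grid n M : {set {ffun 'I_n -> 'I_(M.*2.+1)}} :=
  [set z : {ffun 'I_n -> 'I_(M.*2.+1)} | (\sum_i `|(z i : nat) - M|%N <= M)%N].

(** Give each vector of the box the weight [q] to the power of its l1-norm. On the grid this is at
    least [q ^+ M], and the total weight factors into [n] truncated two-sided geometric series. *)
Lemma card_l1_grid n M (q : R) : 0 < q < 1 ->
  #|l1_grid n M|%:R * q ^+ M <= ((1 + q) / (1 - q)) ^+ n.
Proof.
move=> /andP[q0 q1].
apply: (@le_trans _ _ (\sum_(z : {ffun 'I_n -> 'I_(M.*2.+1)})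
    \prod_i q ^+ `|(z i : nat) - M|%N)).
  rewrite mulr_natl -sumr_const (bigID (mem (l1_grid n M)) predT)/= -[leLHS]addr0.
  apply: lerD; last by apply: sumr_ge0 => z _; apply: prodr_ge0 => i _; rewrite exprn_ge0 // ltW.
  by apply: ler_sum => z; rewrite inE => zM; rewrite prodrXr ler_wiXn2l// ltW.
rewrite -(@bigA_distr_bigA _ _ _ _ _ _ _ (fun (i : 'I_n) (t : 'I_(M.*2.+1)) => q ^+ `|t - M|%N)).
rewrite prodr_const card_ord lerXn2r ?nnegrE//.
- by apply: sumr_ge0 => i _; rewrite exprn_ge0 // ltW.
- by rewrite divr_ge0 ?subr_ge0// ltW// addr_gt0.
have -> : \sum_(t < M.*2.+1) q ^+ `|(t : nat) - M|%N =
    \sum_(0 <= t < M.*2.+1) q ^+ `|t - M|%N by rewrite big_mkord.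
rewrite (big_cat_nat (n := M)) //=; last by lia.
have -> : \sum_(M <= t < M.*2.+1) q ^+ `|t - M|%N = \sum_(i < M.+1) q ^+ i.
  rewrite -{1}[M]add0n big_addn (_ : M.*2.+1 - M = M.+1)%N; last by lia.
  by rewrite big_mkord; apply: eq_bigr => i _; congr (q ^+ _); lia.
rewrite mulrDl mul1r addrC big_mkord; apply: lerD.
  by apply: sum_geometric_le; rewrite q1 ltW.
rewrite (reindex_inj rev_ord_inj)/=.
under eq_bigr => i _.
  have -> : `|(M - i.+1)%N - M|%N = i.+1 by have := ltn_ord i; lia.
  rewrite exprS; over.
rewrite -mulr_sumr ler_pM2l//; apply: sum_geometric_le; rewrite q1 ltW//.
Qed.

Definition grid_point n M (z : {ffun 'I_n -> 'I_(M.*2.+1)}) : 'rV[R]_n :=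
  \row_i ((z i)%:R - M%:R).

(** Cauchy-Schwarz against the all-ones vector. *)
Lemma l1_le_sqn n (u : 'rV[R]_n) : (0 < n)%N -> sqn u = 1 ->
  \sum_i `|u 0 i| <= Num.sqrt n%:R.
Proof.
move=> n0 u1.
set s := Num.sqrt _; have s0 : 0 < s by rewrite sqrtr_gt0 ltr0n.
have s2 : s ^+ 2 = n%:R by rewrite sqr_sqrtr.
have h : 2 * s * \sum_i `|u 0 i| <= n%:R * sqn u + n%:R.
  have -> : n%:R * sqn u + n%:R = n%:R * sqn u + \sum_(i < n) 1 by rewrite sumr_const card_ord.
  rewrite /sqn !mulr_sumr -big_split/=; apply: ler_sum => i _.
  rewrite -s2 -[u 0 i ^+ 2]real_normK ?num_real//; have := sqr_ge0 (s * `|u 0 i| - 1); nra.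
rewrite u1 mulr1 -s2 in h.
rewrite -(ler_pM2l s0); nra.
Qed.

(* The grid step is [1 / (25 sqrt n)]: the integer coordinates of a rounded unit
   vector have l1-norm at most [25 n + n], and rounding costs at most a quarter of
   the squared step times the squared Frobenius norm. *)
Lemma grid_net n N (A : 'M[R]_(n, N)) (S c : R) : (0 < n)%N -> 0 < S -> 0 <= c ->
  \sum_i \sum_j A i j ^+ 2 <= 3 * n%:R * S ->
  (exists u : 'rV[R]_n, sqn (u *m A) < c * S * sqn u) ->
  exists2 z, z \in l1_grid n (26 * n) &
    sqn (grid_point z *m A) < (c + 3 / 50 ^+ 2) * S * sqn (grid_point z).
Proof.
move=> n0 S0 c0 AF [u0 u0A].
have u0p : 0 < sqn u0.
  rewrite lt_neqAle sqn_ge0 andbT eq_sym; apply: contraTN u0A => /eqP u00.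
  by rewrite (sqn_eq0 u00) mul0mx /sqn !big1 ?mulr0 ?ltxx// => j _; rewrite mxE expr0n.
pose t := (Num.sqrt (sqn u0))^-1.
have t2 : t ^+ 2 = (sqn u0)^-1 by rewrite exprVn sqr_sqrtr// ltW.
pose u := t *: u0.
have u1 : sqn u = 1 by rewrite sqnZ t2 mulVf// gt_eqF.
have uA : sqn (u *m A) < c * S.
  by rewrite -scalemxAl sqnZ t2 mulrC ltr_pdivrMr.
set s := Num.sqrt (n%:R : R); have s0 : 0 < s by rewrite sqrtr_gt0 ltr0n.
have s2 : s ^+ 2 = n%:R by rewrite sqr_sqrtr.
pose delta := (25 * s)^-1; have d0 : 0 < delta by rewrite invr_gt0 mulr_gt0.
(* The excess [3 / 50 ^+ 2] over [c] pays for the rounding: it is [delta ^+ 2 / 4] times [3 n]. The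
   functional thus stays strictly negative. *)
have C0 : 0 <= (c + 3 / 50 ^+ 2) * S by rewrite mulr_ge0 ?addr_ge0// ltW.
have [z zu zQ] := round_grid A u d0 C0.
have z1 : (\sum_i `|z i|%N <= 26 * n)%N.
  rewrite -(ler_nat R) natr_sum.
  apply: (@le_trans _ _ (\sum_i (25 * s * `|u 0 i| + 1))).
    apply: ler_sum => i _; rewrite natr_absz intr_norm.
    rewrite -(ler_pM2l d0) mulrDr mulrA mulVf ?mul1r ?mulr1 ?gt_eqF ?mulr_gt0//.
    have := zu i; have := ler_normD (delta * (z i)%:~R - u 0 i) (u 0 i).
    rewrite subrK normrM (gtr0_norm d0); lra.
  rewrite big_split/= -mulr_sumr sumr_const card_ord natrM -s2.
  have := l1_le_sqn n0 u1; rewrite -/s => h.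
  have : 25 * s * \sum_i `|u 0 i| <= 25 * s * s by rewrite ler_wpM2l// mulr_ge0// ltW.
  nra.
have zle i : (`|z i| <= 26 * n)%N.
  by apply: leq_trans z1; rewrite (bigD1 i)//= leq_addr.
have zlt i : (absz (z i + (26 * n)%:Z)%R < (26 * n).*2.+1)%N by have := zle i; lia.
pose y := [ffun i => Ordinal (zlt i)].
have yz i : (y i)%:R - (26 * n)%:R = (z i)%:~R :> R.
  rewrite ffunE /= natr_absz ger0_norm; last by have := zle i; lia.
  by rewrite intrD addrK.
exists y.
  rewrite inE; apply: leq_trans z1; apply: leq_sum => i _.
  by rewrite ffunE/=; have := zle i; lia.
set v := grid_point y.
have /zQ : forall i, (delta *: v) 0 i = delta * (z i)%:~R.
  by move=> i; rewrite !mxE yz.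
rewrite -scalemxAl (sqnZ delta v) (sqnZ delta (v *m A)) u1 => h.
have hA : delta ^+ 2 / 4 * (\sum_i \sum_j A i j ^+ 2) <= 3 / 50 ^+ 2 * S.
  have -> : 3 / 50 ^+ 2 * S = delta ^+ 2 / 4 * (3 * n%:R * S).
    by rewrite -s2 /delta; field; rewrite gt_eqF.
  by rewrite ler_wpM2l// divr_ge0// sqr_ge0.
rewrite -(@ltr_pM2l _ (delta ^+ 2)) ?exprn_gt0//; nra.
Qed.

End Net.

(** * Gaussian integrals and independence *)

Section GaussianIntegral.
Context {R : realType}.
Local Notation mu := (@lebesgue_measure R).

(** The Radon-Nikodym derivative and [normal_pdf] have the same integral over every measurable set,
    hence agree almost everywhere. *)
Lemma ge0_integral_normal_prob (m s : R) (f : R -> \bar R) :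
  measurable_fun setT f -> (forall x, 0 <= f x)%E ->
  (\int[normal_prob m s]_x f x = \int[mu]_x (f x * (normal_pdf m s x)%:E))%E.
Proof.
move=> mf f0; pose nu : {finite_measure set _ -> \bar R} := normal_prob m s.
have dom : nu `<< mu := normal_prob_dominates m s.
rewrite -[LHS](Radon_Nikodym_SigmaFinite.change_of_variables dom)//.
have mpdf : measurable_fun setT (fun x => (normal_pdf m s x)%:E).
  by apply/measurable_EFinP; exact: measurable_normal_pdf.
have iRN := Radon_Nikodym_SigmaFinite.f_integrable dom.
apply: ae_eq_integral => //.
- by apply: emeasurable_funM => //; exact: measurable_int iRN.
- exact: emeasurable_funM.
- apply: ae_eqe_mul2l; apply: integral_ae_eq => // E _ mE.
  by rewrite -Radon_Nikodym_SigmaFinite.f_integral.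
Qed.

Lemma complete_square (lambda v x y : R) : 1 + 2 * lambda * v ^+ 2 != 0 ->
  lambda * (x + v * y) ^+ 2 + y ^+ 2 / 2 =
  lambda / (1 + 2 * lambda * v ^+ 2) * x ^+ 2 + (1 + 2 * lambda * v ^+ 2) *
    (y + 2 * lambda * x * v / (1 + 2 * lambda * v ^+ 2)) ^+ 2 / 2.
Proof. by move=> q0; field. Qed.

Lemma measurable_expR_quad (lambda v x : R) :
  measurable_fun setT (fun y => expR (- (lambda * (x + v * y) ^+ 2))).
Proof.
apply: measurableT_comp => //; apply: measurable_funN => //.
apply: measurable_funM => //; apply: measurable_funX => //.
by apply: measurable_funD => //; apply: measurable_funM.
Qed.

Lemma integral_gauss_quad (lambda v x : R) : 0 < 1 + 2 * lambda * v ^+ 2 ->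
  (\int[normal_prob 0 1]_y (expR (- (lambda * (x + v * y) ^+ 2)))%:E =
   ((Num.sqrt (1 + 2 * lambda * v ^+ 2))^-1 *
    expR (- (lambda / (1 + 2 * lambda * v ^+ 2) * x ^+ 2)))%:E)%E.
Proof.
set q := 1 + _ => q0.
(* Standard deviation and mean of the Gaussian density that remains once the square is completed. *)
pose s := (Num.sqrt q)^-1; pose m := - (2 * lambda * x * v / q).
have sq0 : 0 < Num.sqrt q by rewrite sqrtr_gt0.
have s0 : s != 0 by rewrite invr_neq0// gt_eqF.
have s2 : s ^+ 2 = q^-1 by rewrite exprVn sqr_sqrtr// ltW.
rewrite ge0_integral_normal_prob; last first.
- by move=> y; rewrite lee_fin expR_ge0.
- by apply/measurable_EFinP; exact: measurable_expR_quad.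
pose K := s * expR (- (lambda / q * x ^+ 2)).
transitivity (\int[mu]_y (K%:E * (normal_pdf m s y)%:E))%E.
  apply: eq_integral => y _; rewrite -!EFinM; congr EFin.
  rewrite !normal_pdfE ?oner_neq0// /normal_peak /normal_fun.
  have -> : Num.sqrt (s ^+ 2 * pi *+ 2) = s * Num.sqrt (1 ^+ 2 * pi *+ 2).
    rewrite expr1n mul1r -mulrnAr sqrtrM ?sqr_ge0// sqrtr_sqr ger0_norm//.
    by rewrite invr_ge0 sqrtr_ge0.
  set k := Num.sqrt (1 ^+ 2 * pi *+ 2); rewrite invfM.
  transitivity (k^-1 * expR (- (lambda / q * x ^+ 2) + - (y - m) ^+ 2 / (s ^+ 2 *+ 2))).
    rewrite mulrCA -expRD s2; congr (_ * expR _).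
    have /(congr1 -%R) := complete_square x y (lt0r_neq0 q0).
    rewrite opprD => e; rewrite /m opprK; move: e; rewrite -/q.
    rewrite expr1n subr0 -[2^-1]/(1 *+ 2)^-1 opprD => e.
    rewrite !mulNr e; congr (_ - _).
    by rewrite -[q^-1 *+ 2]mulr_natr invfM invrK [RHS]mulrCA mulrA.
  rewrite expRD /K; set e1 := expR _; set e2 := expR _.
  have -> : s * e1 * (s^-1 / k * e2) = s / s * (k^-1 * (e1 * e2)) by ring.
  by rewrite divff// mul1r.
rewrite ge0_integralZl//; last 3 first.
- by apply/measurable_EFinP; exact: measurable_normal_pdf.
- by move=> y _; rewrite lee_fin normal_pdf_ge0.
- by rewrite lee_fin mulr_ge0 ?expR_ge0// invr_ge0 ltW.
by rewrite integral_normal_pdf mule1.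
Qed.

End GaussianIntegral.

Section Independence.
Context d (T : measurableType d) (R : realType) (P : probability T R).

(* Equipping [T] with the sigma-algebra generated by [G] makes [X] and the
   identity two independent random elements, so that their joint law is a product
   measure. *)
Lemma integral_indep (X : {RV P >-> R}) (G : set (set T)) (f : R * g_sigma_algebraType G -> \bar R) :
  G `<=` measurable -> setI_closed G -> G setT ->
  (forall A B, G A -> measurable B -> P (X @^-1` B `&` A) = (P (X @^-1` B) * P A)%E) ->
  measurable_fun setT f -> (forall z, 0 <= f z)%E ->
  (\int[P]_t f (X t, t) = \int[P]_t \int[distribution P X]_x f (x, t))%E.
Proof.
move=> Gm GI GT XG mf f0.
pose T' := g_sigma_algebraType G.
have mid : measurable_fun setT (id : T -> T').
  move=> _ A mA; rewrite setTI preimage_id.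
  by apply: (smallest_sub _ Gm) mA; exact: sigma_algebra_measurable.
pose idm : {mfun T >-> T'} := HB.pack (id : T -> T') (isMeasurableFun.Build _ _ _ _ _ mid).
have mW : measurable_fun setT (fun t => (X t, t) : R * T').
  by apply: measurable_fun_pair.
pose W : {mfun T >-> (R * T')%type} := HB.pack (fun t => (X t, t) : R * T')
  (isMeasurableFun.Build _ _ _ _ _ mW).
pose dX : probability _ R := distribution P X.
pose dI : probability _ R := distribution P idm.
pose dW : probability _ R := distribution P W.
have dWE (B : set R) (A : set T') : measurable B -> measurable A ->
    dW (B `*` A) = (dX B * dI A)%E.
  move=> mB mA; change (P (X @^-1` B `&` A) = P (X @^-1` B) * P A)%E.
  have mXB : measurable (X @^-1` B) by rewrite -[_ @^-1` _]setTI; exact: measurable_funP.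
  (* For fixed [B] both sides are finite measures in [A]; they agree on the pi-system [G], hence on
     the sigma-algebra it generates. *)
  pose m1 := mrestr P mXB.
  have pXB : (0 <= fine (P (X @^-1` B)))%R by rewrite fine_ge0.
  pose m2 := mscale (NngNum pXB) P.
  have m1E C : m1 C = P (X @^-1` B `&` C) by rewrite setIC.
  have m2E C : m2 C = (P (X @^-1` B) * P C)%E.
    by rewrite /m2/= /mscale/= fineK// fin_num_measure.
  rewrite -m1E -m2E.
  apply: (g_sigma_algebra_measure_unique G Gm (fun=> setT)) => //.
  - by rewrite bigcup_const.
  - by move=> C CG; change (m1 C = m2 C); rewrite m1E m2E XG.
  - move=> _; change (m1 setT < +oo)%E; rewrite m1E setIT; apply: le_lt_trans (ltry 1).
    exact: probability_le1.
transitivity (\int[dW]_z f z)%E.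
  rewrite /dW /distribution ge0_integral_pushforward//.
transitivity (\int[(dX \x dI)]_z f z)%E.
  apply/esym; apply: eq_measure_integral => A mA _.
  by apply: product_measure_unique.
rewrite fubini_tonelli2// /dI /distribution ge0_integral_pushforward//.
- by apply: measurable_fun_fubini_tonelli_G.
- by move=> t _; apply: integral_ge0.
Qed.

End Independence.

(* [normal_prob] lives on [measurableTypeR R] and the law of a real random
   variable on [R] with its default measurable structure; these have the same
   measurable sets but are not convertible as measurable types. *)
Lemma integral_standard_gaussian d (T : measurableType d) (R : realType)
    (P : probability T R) (Y : {RV P >-> R}) (f : R -> \bar R) :
  standard_gaussian Y -> measurable_fun setT f -> (forall x, 0 <= f x)%E ->
  (\int[distribution P Y]_x f x = \int[normal_prob 0 1]_x f x)%E.
Proof.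
move=> Yg mf f0.
have mid : measurable_fun setT (id : measurableTypeR R -> R).
  by move=> _ B mB; rewrite setTI preimage_id.
pose idR : {mfun measurableTypeR R >-> R} := HB.pack (id : measurableTypeR R -> R)
  (isMeasurableFun.Build _ _ _ _ _ mid).
transitivity (\int[distribution (normal_prob 0 1 : probability _ R) idR]_x f x)%E.
  by apply: eq_measure_integral => A mA _; exact: (Yg A mA).
by rewrite /distribution ge0_integral_pushforward.
Qed.

(** * Exponential moments of quadratic forms in independent Gaussians *)

Section GaussianFamily.
Context d (T : measurableType d) (R : realType) (P : probability T R).
Context (I : eqType) (X : I -> {RV P >-> R}).
Hypothesis X_gauss : forall i, standard_gaussian (X i).
Hypothesis X_ind : mutually_independent X.

(** A pi-system generating the sigma-algebra of the [X i] with [i] in [J], made of the very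
    intersections on which mutual independence is stated. *)
Definition cylinders (J : seq I) : set (set T) :=
  [set A | exists2 B : I -> set R, (forall i, measurable (B i)) &
           A = \bigcap_(i in [set` J]) X i @^-1` B i].

Definition determined_by (J : seq I) (f : T -> R) : Prop :=
  measurable_fun (setT : set (g_sigma_algebraType (cylinders J))) f.

Lemma cylinders_measurable J : cylinders J `<=` measurable.
Proof.
move=> _ [B mB ->]; apply: fin_bigcap_measurable => // i _.
by rewrite -[_ @^-1` _]setTI; exact: measurable_funP.
Qed.

Lemma cylinders_setI J : setI_closed (cylinders J).
Proof.
move=> _ _ [B mB ->] [C mC ->]; exists (fun i => B i `&` C i).
  by move=> i; exact: measurableI.
by rewrite -bigcapI.
Qed.

Lemma cylinders_setT J : cylinders J setT.
Proof.
by exists (fun=> setT) => //; rewrite bigcapT.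
Qed.

Lemma cylinders_sub J J' : {subset J <= J'} -> cylinders J `<=` cylinders J'.
Proof.
move=> JJ' _ [B mB ->]; exists (fun i => if i \in J then B i else setT).
  by move=> i; case: ifP.
apply/seteqP; split => t Ht i /= iJ'; first by case: ifPn => // iJ; exact: Ht.
by have := Ht i (JJ' _ iJ'); rewrite /= iJ'.
Qed.

Lemma determined_by_sub J J' f : {subset J <= J'} ->
  determined_by J f -> determined_by J' f.
Proof.
move=> JJ' mf _ B mB; have := mf measurableT B mB.
exact: sub_smallest2r (cylinders_sub JJ') _.
Qed.

Lemma determined_by_coord J i : i \in J -> determined_by J (X i).
Proof.
move=> iJ _ B mB; rewrite setTI; apply: sub_sigma_algebra.
exists (fun j => if j == i then B else setT); first by move=> j; case: ifP.
apply/seteqP; split => t /= Ht; last by have := Ht i iJ; rewrite /= eqxx.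
by move=> j _ /=; case: eqVneq => // ->.
Qed.

Lemma determined_by_lin s (v : I -> R) J : {subset s <= J} ->
  determined_by J (fun t => \sum_(i <- s) v i * X i t).
Proof.
rewrite /determined_by; elim: s => [_|i s ih sJ].
  by under eq_fun do rewrite big_nil; exact: measurable_cst.
under eq_fun do rewrite big_cons; apply: measurable_funD.
  apply: measurable_funM; first exact: measurable_cst.
  by apply: determined_by_coord; apply: sJ; rewrite inE eqxx.
by apply: ih => j js; apply: sJ; rewrite inE js orbT.
Qed.

Lemma determined_by_quad (L : seq (R * seq I)) (v : I -> R) J :
  {subset flatten [seq p.2 | p <- L] <= J} ->
  determined_by J (fun t => \sum_(p <- L) p.1 * (\sum_(i <- p.2) v i * X i t) ^+ 2).
Proof.
rewrite /determined_by; elim: L => [_|p L ih LJ].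
  by under eq_fun do rewrite big_nil; exact: measurable_cst.
under eq_fun do rewrite big_cons; apply: measurable_funD.
  apply: measurable_funM; first exact: measurable_cst.
  apply: measurable_funX; apply: determined_by_lin => i ip.
  by apply: LJ; rewrite /= mem_cat ip.
by apply: ih => i iL; apply: LJ; rewrite /= mem_cat iL orbT.
Qed.

(** Since [i] is not in [J], the variable [X i] is independent of the pair [Z], [H] and can be
    integrated first, with these two frozen. *)
Lemma integral_peel (i : I) (J : seq I) (lambda v : R) (Z H : T -> R) : i \notin J -> uniq J ->
  determined_by J Z -> determined_by J H -> (forall t, 0 <= H t) ->
  0 < 1 + 2 * lambda * v ^+ 2 ->
  (\int[P]_t (expR (- (lambda * (Z t + v * X i t) ^+ 2)) * H t)%:E =
   (Num.sqrt (1 + 2 * lambda * v ^+ 2))^-1%:E *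
   \int[P]_t (expR (- (lambda / (1 + 2 * lambda * v ^+ 2) * Z t ^+ 2)) * H t)%:E)%E.
Proof.
move=> iJ uJ mZ mH H0 q0.
have sg := @cylinders_measurable J.
pose f (z : R * g_sigma_algebraType (cylinders J)) : \bar R :=
  (expR (- (lambda * (Z z.2 + v * z.1) ^+ 2)) * H z.2)%:E.
have mfst : measurable_fun setT (fst : R * g_sigma_algebraType (cylinders J) -> R) by exact: measurable_fst.
have mZ2 : measurable_fun setT (fun z : R * g_sigma_algebraType (cylinders J) => Z z.2).
  by apply: (measurableT_comp mZ); exact: measurable_snd.
have mH2 : measurable_fun setT (fun z : R * g_sigma_algebraType (cylinders J) => H z.2).
  by apply: (measurableT_comp mH); exact: measurable_snd.
have mf : measurable_fun setT f.
  apply/measurable_EFinP; apply: measurable_funM => //.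
  apply: measurableT_comp => //; apply: measurable_funN => //.
  apply: measurable_funM => //; apply: measurable_funX => //.
  by apply: measurable_funD => //; apply: measurable_funM.
have f0 z : (0 <= f z)%E by rewrite lee_fin mulr_ge0 ?expR_ge0.
have wd (g : T -> R) : determined_by J g -> measurable_fun setT g.
  move=> mg _ B mB; have := mg measurableT B mB.
  by apply: smallest_sub => //; exact: sigma_algebra_measurable.
transitivity (\int[P]_t f (X i t, t))%E; first by [].
rewrite (integral_indep sg (@cylinders_setI J) (cylinders_setT J) _ mf f0); last first.
  move=> _ B [C mC ->] mB.
  have e (Q : I -> set R) : (forall j, j \in J -> Q j = C j) ->
      \bigcap_(j in [set` J]) X j @^-1` Q j = \bigcap_(j in [set` J]) X j @^-1` C j.
    by move=> QC; apply: eq_bigcapr => j jJ; rewrite QC.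
  (* Mutual independence is applied to [i :: J] with the set [B] at [i]; by [e], this change of the
     family is invisible on [J]. *)
  pose Q j := if j == i then B else C j.
  have QC j : j \in J -> Q j = C j.
    by rewrite /Q; case: eqVneq => // -> ji; rewrite ji in iJ.
  have mQ j : measurable (Q j) by rewrite /Q; case: ifP.
  have := @X_ind (i :: J) Q; rewrite /= iJ uJ => /(_ isT mQ).
  have -> : [set` i :: J] = i |` [set` J].
    apply/seteqP; split => j /=; rewrite inE; first by case/predU1P => [->|]; [left|right].
    by case=> [->|->]; rewrite ?eqxx ?orbT.
  rewrite big_cons bigcap_setU1 /= e// {1 2}/Q eqxx => ->.
  by congr (_ * _)%E; rewrite -(@X_ind J Q uJ mQ) e.
rewrite -ge0_integralZl//; last 2 first.
- apply/measurable_EFinP; apply: measurable_funM; last exact: wd.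
  apply: measurableT_comp => //; apply: measurable_funN => //.
  by apply: measurable_funM => //; apply: measurable_funX => //; exact: wd.
- by move=> t _; rewrite lee_fin mulr_ge0 ?expR_ge0.
apply: eq_integral => t _.
rewrite (integral_standard_gaussian (X_gauss i)); last 2 first.
- by apply: (measurableT_comp mf); exact: measurable_fun_pair.
- by move=> x; exact: f0.
rewrite /f/=; under eq_integral do rewrite EFinM.
rewrite ge0_integralZr//; last 2 first.
- by apply/measurable_EFinP; exact: measurable_expR_quad.
- by rewrite lee_fin.
by rewrite integral_gauss_quad// -!EFinM; congr EFin; exact: esym (mulrA _ _ _).
Qed.

(** Peeling off one variable replaces [lambda] by [lambda / q]. The factors telescope, because
    [1 + 2 (lambda / q) V = Q / q]. *)
Lemma integral_gauss_linear s J (lambda : R) (v : I -> R) (Z H : T -> R) :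
  uniq (s ++ J) -> determined_by J Z -> determined_by J H -> (forall t, 0 <= H t) ->
  0 < 1 + 2 * lambda * \sum_(i <- s) v i ^+ 2 ->
  (\int[P]_t (expR (- (lambda * (Z t + \sum_(i <- s) v i * X i t) ^+ 2)) * H t)%:E =
   (Num.sqrt (1 + 2 * lambda * \sum_(i <- s) v i ^+ 2))^-1%:E *
   \int[P]_t (expR (- (lambda / (1 + 2 * lambda * \sum_(i <- s) v i ^+ 2) * Z t ^+ 2)) * H t)%:E)%E.
Proof.
elim: s lambda => [|i s ih] lambda.
  move=> _ _ _ _; rewrite !big_nil mulr0 addr0 sqrtr1 invr1 mul1e mulr1 => _.
  by apply: eq_integral => t _; rewrite big_nil addr0.
move=> /=/andP[iJ uJ] mZ mH H0; rewrite !big_cons.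
set V := \sum_(_ <- _) _ => q0.
have V0 : 0 <= V by apply: sumr_ge0 => j _; exact: sqr_ge0.
have q1 : 0 < 1 + 2 * lambda * v i ^+ 2.
  (* For negative [lambda], positivity of [q] is inherited from [Q], as [V] is non-negative. *)
  have [l0|l0] := leP 0 lambda.
    by rewrite ltr_wpDr// mulr_ge0 ?sqr_ge0// mulr_ge0.
  apply: lt_le_trans q0 _; rewrite lerD2l mulrDr gerDl.
  by rewrite mulr_le0_ge0// mulr_ge0_le0// ltW.
under eq_integral do rewrite big_cons [v i * _ + _]addrC addrA.
have sJ : {subset J <= s ++ J} by move=> j jJ; rewrite mem_cat jJ orbT.
rewrite (@integral_peel i (s ++ J))//; last 2 first.
- apply: measurable_funD; first exact: determined_by_sub mZ.
  by apply: determined_by_lin => j js; rewrite mem_cat js.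
- exact: determined_by_sub mH.
set q := 1 + 2 * lambda * v i ^+ 2 in q1 *; set Q := 1 + _ in q0 *.
have e : 1 + 2 * (lambda / q) * V = Q / q by rewrite /Q /q; field; rewrite gt_eqF.
rewrite ih// -/V e; last by rewrite divr_gt0.
rewrite muleA -EFinM -invfM -sqrtrM ?(ltW q1)// (mulrC q) divfK ?gt_eqF//.
by have -> : lambda / q / (Q / q) = lambda / Q by field; rewrite !gt_eqF.
Qed.

(** Each entry of [L] pairs a coefficient with a block of indices. The blocks are disjoint, so the
    first is integrated with [Z = 0] while the others form [H]. *)
Lemma integral_gauss_blocks (L : seq (R * seq I)) (v : I -> R) :
  uniq (flatten [seq p.2 | p <- L]) ->
  (forall p, p \in L -> 0 < 1 + 2 * p.1 * \sum_(i <- p.2) v i ^+ 2) ->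
  (\int[P]_t (expR (- \sum_(p <- L) p.1 * (\sum_(i <- p.2) v i * X i t) ^+ 2))%:E =
   (\prod_(p <- L) (Num.sqrt (1 + 2 * p.1 * \sum_(i <- p.2) v i ^+ 2))^-1)%:E)%E.
Proof.
elim: L => [_ _|[lambda s] L ih /= uL Lp].
  rewrite big_nil; under eq_integral do rewrite big_nil oppr0 expR0.
  by rewrite integral_cst// mul1e; exact: probability_setT.
under eq_integral do rewrite big_cons /= opprD expRD -[in X in X ^+ 2](add0r (\sum_(_ <- s) _)).
rewrite big_cons EFinM -ih; last 2 first.
- by move: uL; rewrite cat_uniq => /and3P[].
- by move=> p pL; apply: Lp; rewrite inE pL orbT.
rewrite (@integral_gauss_linear s (flatten [seq p.2 | p <- L]) _ _ (fun=> 0))//.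
- congr (_ * _)%E; apply: eq_integral => t _.
  by rewrite expr0n mulr0 oppr0 expR0 mul1r.
- exact: measurable_cst.
- apply: measurableT_comp => //; apply: measurable_funN => //.
  exact: determined_by_quad.
- exact: (Lp (lambda, s) (mem_head _ _)).
Qed.

End GaussianFamily.

(** * Deviation bounds *)

Section Numerics.
Context {R : realType}.

(** Rational lower bounds start from [1 + x <= exp x] at a small argument and are squared
    repeatedly, [z] being the square rounded down. *)
Lemma expR_double_ge (x y z : R) : 0 <= y -> y <= expR x -> z <= y ^+ 2 ->
  z <= expR (x + x).
Proof.
move=> y0 yx zy; rewrite (le_trans zy)// expRD -expr2.
by rewrite lerXn2r// nnegrE expR_ge0.
Qed.

(** The upper bound comes from a lower bound at a negative argument: [exp (- 1 / 2) >= 3 / 5] gives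
    [exp 4 <= (5 / 3) ^+ 8 < 61]. *)
Lemma expR4_le : expR 4 <= 61 :> R.
Proof.
pose x : R := - (1 / 32).
have h0 : 31 / 32 <= expR x by apply: le_trans (expR_ge1Dx _); rewrite /x; lra.
have h1 : 61 / 65 <= expR (x + x) by apply: expR_double_ge h0 _; lra.
have h2 : 59 / 67 <= expR (x + x + (x + x)) by apply: expR_double_ge h1 _; lra.
have h3 : 69 / 89 <= expR (x + x + (x + x) + (x + x + (x + x))).
  by apply: expR_double_ge h2 _; lra.
have h4 : 3 / 5 <= expR (- (1 / 2) : R).
  have -> : - (1 / 2) = x + x + (x + x) + (x + x + (x + x)) +
    (x + x + (x + x) + (x + x + (x + x))) :> R by rewrite /x; lra.
  by apply: expR_double_ge h3 _; lra.
have -> : 4 = 8%:R * (1 / 2) :> R by lra.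
rewrite expRM_natl; have := expR_gt0 (1 / 2 : R).
have := expRxMexpNx_1 (1 / 2 : R); move: h4; move: (expR _) (expR _) => e f fe ef e0.
have e1 : e <= 5 / 3 by nra.
have : e ^+ 8 <= (5 / 3) ^+ 8 by rewrite lerXn2r// nnegrE ltW.
lra.
Qed.

Lemma le53_expR : 53 <= expR (112 / 25) :> R.
Proof.
pose x : R := 7 / 50.
have h0 : 57 / 50 <= expR x by apply: le_trans (expR_ge1Dx _); rewrite /x; lra.
have h1 : 9 / 7 <= expR (x + x) by apply: expR_double_ge h0 _; lra.
have h2 : 33 / 20 <= expR (x + x + (x + x)) by apply: expR_double_ge h1 _; lra.
have h3 : 27 / 10 <= expR (28 / 25 : R).
  have -> : 28 / 25 = x + x + (x + x) + (x + x + (x + x)) :> R by rewrite /x; lra.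
  by apply: expR_double_ge h2 _; lra.
have h4 : 729 / 100 <= expR (28 / 25 + 28 / 25 : R) by apply: expR_double_ge h3 _; lra.
have -> : 112 / 25 = 28 / 25 + 28 / 25 + (28 / 25 + 28 / 25) :> R by lra.
by apply: expR_double_ge h4 _; lra.
Qed.

(** By convexity the exponential lies below its chord over [[0, 4]]. *)
Lemma expR4M_le (x : R) : 0 <= x <= 1 -> expR (4 * x) <= 1 + 60 * x.
Proof.
move=> /andP[x0 x1].
have := @convex_expR R (Itv01 x0 x1) 4 0.
rewrite !convRE/= mulr0 addr0 expR0 mulr1 mulrC => h.
apply: le_trans h _; rewrite /unstable.onem; have := expR4_le; nra.
Qed.

Lemma invsqrt_le_expR (y x : R) : 0 < y -> expR (- (2 * x)) <= y ->
  (Num.sqrt y)^-1 <= expR x.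
Proof.
move=> y0 h; rewrite -[expR x]invrK lef_pV2 ?posrE ?sqrtr_gt0// ?invr_gt0 ?expR_gt0//.
rewrite -expRN -(@ler_pXn2r _ 2)// ?nnegrE ?sqrtr_ge0 ?expR_ge0//.
by rewrite sqr_sqrtr ?(ltW y0)// -expRM_natl mulrN.
Qed.

End Numerics.

Section Chernoff.
Context d (T : measurableType d) (R : realType) (P : probability T R).

Lemma expR_markov (Y : T -> R) (c M : R) : measurable_fun setT Y ->
  (\int[P]_t (expR (Y t))%:E <= M%:E)%E ->
  (P [set t | (c <= Y t)%R] <= (expR (- c) * M)%:E)%E.
Proof.
move=> mY YM.
pose X : {RV P >-> R} := HB.pack Y (isMeasurableFun.Build _ _ _ _ Y mY).
(* The exponential parameter is already part of [Y], hence the parameter 1. *)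
apply: le_trans (chernoff X c ltr01) _; rewrite mul1r EFinM muleC.
apply: lee_wpmul2l; first by rewrite lee_fin expR_ge0.
by rewrite /mmt_gen_fun unlock; under eq_integral do rewrite /= mulr1.
Qed.

End Chernoff.

(** * Upper tails of chi-square sums *)

Section Deviation.
Context d (T : measurableType d) (R : realType) (P : probability T R).
Context (I : eqType) (X : I -> {RV P >-> R}).
Hypothesis X_gauss : forall i, standard_gaussian (X i).
Hypothesis X_ind : mutually_independent X.

(** The blocks are singletons, with coefficients [- tau k]. *)
Lemma integral_chi_square (K : finType) (c : K -> I) (tau : K -> R) :
  injective c -> (forall k, tau k < 1 / 2) ->
  (\int[P]_t (expR (\sum_k tau k * X (c k) t ^+ 2))%:E =
   (\prod_k (Num.sqrt (1 - 2 * tau k))^-1)%:E)%E.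
Proof.
move=> cI tau1.
have := @integral_gauss_blocks _ _ _ _ _ _ X_gauss X_ind
  [seq (- tau k, [:: c k]) | k <- index_enum K] (fun=> 1).
rewrite -map_comp /= (_ : flatten _ = [seq c k | k <- index_enum K]); last first.
  by elim: (index_enum K) => //= k s ->.
rewrite map_inj_uniq ?index_enum_uniq// big_map => /(_ isT) h.
rewrite [RHS](_ : _ = (\prod_k (Num.sqrt (1 + 2 * - tau k * \sum_(i <- [:: c k]) 1 ^+ 2))^-1)%:E); last first.
  congr EFin; apply: eq_bigr => k _.
  by rewrite big_seq1 expr1n mulr1 mulrN.
rewrite -h.
  apply: eq_integral => t _; congr (expR _)%:E.
  rewrite big_map -sumrN; apply: eq_bigr => k _.
  by rewrite big_seq1 /= mul1r mulNr opprK.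
move=> p /mapP[k _ ->] /=; rewrite big_seq1 expr1n; have := tau1 k; lra.
Qed.

(** Chernoff with parameter [1 / 6]: each variable contributes [(2 / 3)^(-1/2) <= exp (15 / 64)],
    against [exp (- 16 / 64)] from the threshold. *)
Lemma chi_square_tail (n : nat) (c : 'I_n -> I) : injective c ->
  (P [set t | ((3 / 2) * n%:R <= \sum_i X (c i) t ^+ 2)%R] <=
   (expR (- (n%:R / 64)))%:E)%E.
Proof.
move=> cI.
have mY : measurable_fun setT (fun t => \sum_i (1 / 6) * X (c i) t ^+ 2).
  apply: measurable_sum => i; apply: measurable_funM => //.
  by apply: measurable_funX.
have lt12 : 1 / 6 < 1 / 2 :> R by lra.
have YE := @integral_chi_square _ c (fun=> 1 / 6) cI (fun=> lt12).
have := @expR_markov _ _ _ P _ (n%:R / 4) _ mY; rewrite YE.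
move=> /(_ _ (lexx _)) => h; clear YE mY.
have -> : [set t | 3 / 2 * n%:R <= \sum_i X (c i) t ^+ 2] =
  [set t | n%:R / 4 <= \sum_i (1 / 6) * X (c i) t ^+ 2].
  by apply/seteqP; split => t /=; rewrite -mulr_sumr; lra.
apply: le_trans h _; rewrite lee_fin prodr_const card_ord.
apply: (@le_trans _ _ (expR (- (n%:R / 4)) * expR (n%:R * (15 / 64)))).
  rewrite ler_wpM2l ?expR_ge0// expRM_natl lerXn2r ?nnegrE ?expR_ge0// ?invr_ge0 ?sqrtr_ge0//.
  apply: invsqrt_le_expR; first by lra.
  have h1 : 79 / 64 <= expR (15 / 64 : R) by apply: le_trans (expR_ge1Dx _); lra.
  have := expRxMexpNx_1 (2 * (15 / 64) : R); rewrite mulr_natl mulr2n expRD.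
  have := expR_gt0 (- (15 / 64 + 15 / 64) : R).
  move: (expR _) (expR _) h1 => e f h1 f0 ef; nra.
by rewrite -expRD ler_expR; lra.
Qed.

(** Chernoff with parameter [1 / (4 a)]: as [tau k <= 1 / 4], each factor is at most
    [exp (2 tau k)], which leaves one of the three [tau k] in the threshold. *)
Lemma weighted_chi_square_tail (K : finType) (c : K -> I) (a : R) (w : K -> R) :
  injective c -> 0 < a -> (forall k, 0 <= w k <= a) ->
  (P [set t | (3 * \sum_k w k <= \sum_k w k * X (c k) t ^+ 2)%R] <=
   (expR (- ((\sum_k w k) / (4 * a))))%:E)%E.
Proof.
move=> cI a0 wa.
pose tau k := w k / (4 * a).
have tau_le k : 0 <= tau k <= 1 / 4.
  have /andP[w0 w1] := wa k; rewrite /tau divr_ge0 ?mulr_ge0 ?(ltW a0)//=.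
  by rewrite ler_pdivrMr ?mulr_gt0//; lra.
have mY : measurable_fun setT (fun t => \sum_k tau k * X (c k) t ^+ 2).
  apply: measurable_sum => i; apply: measurable_funM => //.
  by apply: measurable_funX.
have tau_lt k : tau k < 1 / 2 by have := tau_le k; lra.
have YE := @integral_chi_square K c tau cI tau_lt.
have := @expR_markov _ _ _ P _ (3 * \sum_k tau k) _ mY; rewrite YE.
move=> /(_ _ (lexx _)) => h; clear YE mY.
have a40 : 0 < (4 * a)^-1 by rewrite invr_gt0 mulr_gt0.
have -> : [set t | 3 * \sum_k w k <= \sum_k w k * X (c k) t ^+ 2] =
  [set t | 3 * \sum_k tau k <= \sum_k tau k * X (c k) t ^+ 2].
  have e t : \sum_k tau k * X (c k) t ^+ 2 =
      (\sum_k w k * X (c k) t ^+ 2) / (4 * a).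
    by rewrite mulr_suml; apply: eq_bigr => k _; rewrite /tau mulrAC.
  by apply/seteqP; split => t /=; rewrite e -mulr_suml mulrA ler_pM2r.
apply: le_trans h _; rewrite lee_fin.
apply: (@le_trans _ _ (expR (- (3 * \sum_k tau k)) * expR (\sum_k 2 * tau k))).
  rewrite ler_wpM2l ?expR_ge0// expR_sum; apply: ler_prod => k _.
  rewrite invr_ge0 sqrtr_ge0/=; have /andP[t0 t1] := tau_le k.
  apply: invsqrt_le_expR; first by lra.
  rewrite expRN; apply: (@le_trans _ _ (1 + 2 * (2 * tau k))^-1).
    by rewrite lef_pV2 ?posrE ?expR_gt0 ?expR_ge1Dx//; lra.
  by rewrite -[leLHS]mul1r ler_pdivrMr; nra.
by rewrite -mulr_sumr -mulr_suml -expRD ler_expR; lra.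
Qed.

End Deviation.

(** Take [q = 26 / 27]: then [(1 + q) / (1 - q) = 53] and [q ^+ 26 >= 1 / e], so there are at most
    [(53 e)^n] points; finally [53 <= exp (112 / 25)]. *)
Lemma card_l1_grid_le (R : realType) n :
  #|l1_grid n (26 * n)|%:R <= expR (n%:R * (137 / 25)) :> R.
Proof.
have q01 : 0 < (26 / 27 : R) < 1 by apply/andP; split; lra.
have := @card_l1_grid R n (26 * n) _ q01.
have -> : (1 + 26 / 27) / (1 - 26 / 27) = 53 :> R by field; lra.
rewrite exprM => h.
have qp : 0 < (26 / 27) ^+ 26 :> R by rewrite exprn_gt0//; lra.
have q26 : expR (- 1) <= (26 / 27) ^+ 26 :> R.
  rewrite (_ : - 1 = 26%:R * - (1 / 26) :> R); last by field.
  rewrite expRM_natl lerXn2r ?nnegrE ?expR_ge0//.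
  rewrite expRN -[leRHS]invrK lef_pV2 ?posrE ?expR_gt0//.
  by apply: le_trans (expR_ge1Dx _); lra.
have : expR (- n%:R) <= ((26 / 27) ^+ 26) ^+ n :> R.
  by rewrite -[- n%:R]mulrN1 expRM_natl lerXn2r ?nnegrE ?expR_ge0// ltW.
move: h; set Q := _ ^+ n => h Qn.
have Q0 : 0 < Q := lt_le_trans (expR_gt0 _) Qn.
have h53 : 53 ^+ n <= expR (n%:R * (112 / 25)) :> R.
  by rewrite expRM_natl lerXn2r ?nnegrE ?expR_ge0 ?le53_expR.
have -> : n%:R * (137 / 25) = n%:R + n%:R * (112 / 25) :> R by lra.
rewrite expRD; apply: (@le_trans _ _ (53 ^+ n / Q)); first by rewrite ler_pdivlMr.
rewrite mulrC; apply: ler_pM; rewrite ?invr_ge0 ?exprn_ge0 ?(ltW Q0)//.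
by rewrite -[expR n%:R]invrK -expRN lef_pV2// posrE expR_gt0.
Qed.

Lemma measure_bigsetU_le_card d (T : measurableType d) (R : realType)
    (P : probability T R) (I : eqType) (r : seq I) (F : I -> set T) (p : R) :
  (forall i, measurable (F i)) -> (forall i, (P (F i) <= p%:E)%E) ->
  (P (\big[setU/set0]_(i <- r) F i) <= ((size r)%:R * p)%:E)%E.
Proof.
move=> mF Fp; elim: r => [|i r ih]; first by rewrite big_nil measure0 mul0r.
rewrite big_cons /= -natr1 mulrDl mul1r addrC EFinD.
apply: le_trans (leeD (Fp i) ih); apply: measureU2 => //.
exact: bigsetU_measurable.
Qed.

Lemma measurable_set_lt d (T : measurableType d) (R : realType) (f g : T -> R) :
  measurable_fun setT f -> measurable_fun setT g -> measurable [set t | f t < g t].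
Proof.
move=> mf mg; rewrite (_ : [set t | _] = ~` (setT `&` [set t | g t <= f t])).
  by apply: measurableC; exact: measurable_fun_le.
by rewrite setTI; apply/seteqP; split => t /=; rewrite ltNge => /negP.
Qed.

(** * The event of high probability *)

Section GoodEvent.
Context d (T : measurableType d) (R : realType) (P : probability T R).
Context (n : nat) (X : 'I_n * nat -> {RV P >-> R}).
Hypothesis X_gauss : forall i, standard_gaussian (X i).
Hypothesis X_ind : mutually_independent X.
Context (N : nat) (c : 'I_N -> nat) (s : 'I_N -> R) (a : R).
Hypothesis c_inj : injective c.
Hypothesis a_gt0 : 0 < a.
Hypothesis s_le : forall j, s j ^+ 2 <= a.

Let S := \sum_j s j ^+ 2.

Definition weighted_gaussian (t : T) : 'M[R]_(n, N) := \matrix_(i, j) (s j * X (i, c j) t).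

Lemma sqn_weighted_gaussian (z : 'rV[R]_n) t :
  sqn (z *m weighted_gaussian t) =
  \sum_j s j ^+ 2 * (\sum_i z 0 i * X (i, c j) t) ^+ 2.
Proof.
apply: eq_bigr => j _; rewrite mxE -exprMn mulr_sumr; congr (_ ^+ 2).
by apply: eq_bigr => i _; rewrite mxE mulrCA.
Qed.

Lemma measurable_sqn_weighted_gaussian (z : 'rV[R]_n) :
  measurable_fun setT (fun t => sqn (z *m weighted_gaussian t)).
Proof.
under eq_fun do rewrite sqn_weighted_gaussian.
apply: measurable_sum => j; apply: measurable_funM => //.
apply: measurable_funX; apply: measurable_sum => i.
exact: measurable_funM.
Qed.

(** Chernoff with [lambda = 30 / (a |z|^2)]: column [j] contributes
    [(1 + 60 w)^(-1/2) <= exp (- 2 w)], where [w = s j ^+ 2 / a <= 1], and the threshold costs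
    [exp (30 C S / a)]. *)
Lemma small_image_tail (z : 'rV[R]_n) (C : R) :
  (P [set t | (sqn (z *m weighted_gaussian t) < C * S * sqn z)%R] <=
   (expR (- (S / a * (2 - 30 * C))))%:E)%E.
Proof.
set E := [set t | _].
have [z0|z0] := eqVneq (sqn z) 0.
  suff -> : E = set0 by rewrite measure0 lee_fin expR_ge0.
  by apply/seteqP; split => t //=; rewrite /E/= z0 mulr0 ltNge sqn_ge0.
have zp : 0 < sqn z by rewrite lt_neqAle sqn_ge0 eq_sym z0.
pose lambda := 30 / (a * sqn z).
have l0 : 0 < lambda by rewrite divr_gt0// mulr_gt0.
have sx j : 0 <= s j ^+ 2 / a <= 1.
  by rewrite divr_ge0 ?sqr_ge0 ?(ltW a_gt0)//= ler_pdivrMr// mul1r.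
have ls j : 1 + 2 * (lambda * s j ^+ 2) * sqn z = 1 + 60 * (s j ^+ 2 / a).
  by rewrite /lambda; field; rewrite z0 gt_eqF.
pose v (p : 'I_n * nat) := z 0 p.1.
pose L := [seq (lambda * s j ^+ 2, [seq (i, c j) | i <- index_enum 'I_n]) | j <- index_enum 'I_N].
have uL : uniq (flatten [seq p.2 | p <- L]).
  rewrite -map_comp; apply: (@allpairs_uniq _ _ _ (fun j i => (i, c j))).
  - exact: index_enum_uniq.
  - exact: index_enum_uniq.
  - by move=> [j i] [j' i'] _ _ /= [-> /c_inj ->].
have pL p : p \in L -> 0 < 1 + 2 * p.1 * \sum_(i <- p.2) v i ^+ 2.
  move=> /mapP[j _ ->] /=; rewrite big_map ls.
  by have /andP[] := sx j; lra.
have := integral_gauss_blocks X_gauss X_ind uL pL; rewrite big_map /=.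
set M := \prod_(j <- _) _ => LM.
have mY : measurable_fun setT (fun t => - (lambda * sqn (z *m weighted_gaussian t))).
  apply: measurable_funN; apply: measurable_funM => //.
  exact: measurable_sqn_weighted_gaussian.
have YM : (\int[P]_t (expR (- (lambda * sqn (z *m weighted_gaussian t))))%:E <= M%:E)%E.
  rewrite -LM le_eqVlt; apply/orP; left; apply/eqP; apply: eq_integral => t _.
  congr (expR (- _))%:E; rewrite big_map sqn_weighted_gaussian mulr_sumr.
  by apply: eq_bigr => j _; rewrite /= big_map mulrA.
have := @expR_markov _ _ _ P _ (- (lambda * (C * S * sqn z))) M mY YM.
have : E `<=` [set t | - (lambda * (C * S * sqn z)) <= - (lambda * sqn (z *m weighted_gaussian t))].
  by move=> t; rewrite /E /= lerN2 ler_pM2l// => /ltW.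
have mle : measurable [set t | - (lambda * (C * S * sqn z)) <= - (lambda * sqn (z *m weighted_gaussian t))].
  rewrite -[X in measurable X]setTI; apply: measurable_fun_le => //.
have mE : measurable E.
  apply: measurable_set_lt => //.
  exact: measurable_sqn_weighted_gaussian.
move=> EF h; apply: le_trans (le_measure _ _ _ EF) _; rewrite ?inE//.
apply: le_trans h _; rewrite lee_fin opprK.
have -> : lambda * (C * S * sqn z) = 30 * C * (S / a).
  by rewrite /lambda; field; rewrite z0 gt_eqF.
apply: (@le_trans _ _ (expR (30 * C * (S / a)) * expR (\sum_j - (2 * (s j ^+ 2 / a))))).
  rewrite ler_wpM2l ?expR_ge0// expR_sum; apply: ler_prod => j _.
  rewrite invr_ge0 sqrtr_ge0/= big_map ls; have /andP[s0 s1] := sx j.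
  apply: invsqrt_le_expR; first by lra.
  have -> : - (2 * - (2 * (s j ^+ 2 / a))) = 4 * (s j ^+ 2 / a) by lra.
  exact: expR4M_le.
rewrite -expRD ler_expR sumrN -mulr_sumr -mulr_suml -/S; lra.
Qed.

(** Three bad events are removed: a long column 0, a large Frobenius norm, and a lattice point with
    small image. Outside them [grid_net] excludes any [u] violating the bound. *)
Lemma good_event (kappa : R) : (0 < n)%N -> 0 <= kappa -> n%:R / 16 <= S / a ->
  11 / 2 * n%:R <= S / a * (2 - 30 * (kappa + 3 / 50 ^+ 2)) ->
  exists E : set T, [/\ measurable E,
    ((1 - 3 * expR (- (n%:R / 64)))%:E <= P E)%E &
    forall t, E t -> \sum_i X (i, 0%N) t ^+ 2 <= 3 / 2 * n%:R /\
      forall u, kappa * S * sqn u <= sqn (u *m weighted_gaussian t)].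
Proof.
move=> n0 k0 Sa1 Sa2.
have n0R : 0 < n%:R :> R by rewrite ltr0n.
have S0 : 0 < S.
  by rewrite -(pmulr_lgt0 S (x := a^-1)) ?invr_gt0// (lt_le_trans _ Sa1)// divr_gt0.
pose c2 (p : 'I_n * 'I_N) := (p.1, c p.2).
have c2_inj : injective c2 by move=> [i j] [i' j'] [-> /c_inj ->].
pose w (p : 'I_n * 'I_N) := s p.2 ^+ 2.
have wS : \sum_p w p = n%:R * S.
  rewrite -(pair_bigA _ (fun (i : 'I_n) j => s j ^+ 2))/= sumr_const card_ord.
  by rewrite mulr_natl.
have wa p : 0 <= w p <= a by rewrite sqr_ge0 s_le.
pose E1 := [set t | 3 / 2 * n%:R <= \sum_i X (i, 0%N) t ^+ 2].
pose E2 := [set t | 3 * \sum_p w p <= \sum_p w p * X (c2 p) t ^+ 2].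
pose E3 (y : {ffun 'I_n -> 'I_((26 * n).*2.+1)}) := [set t |
  sqn (grid_point y *m weighted_gaussian t) <
  (kappa + 3 / 50 ^+ 2) * S * sqn (grid_point y)].
pose E4 := \big[setU/set0]_(y <- enum (l1_grid n (26 * n))) E3 y.
have mE1 : measurable E1.
  rewrite -[E1]setTI; apply: measurable_fun_le => //.
  by apply: measurable_sum => i; exact: measurable_funX.
have mE2 : measurable E2.
  rewrite -[E2]setTI; apply: measurable_fun_le => //.
  apply: measurable_sum => i; apply: measurable_funM => //.
  by apply: measurable_funX.
have mE3 y : measurable (E3 y).
  apply: measurable_set_lt => //.
  exact: measurable_sqn_weighted_gaussian.
have mE4 : measurable E4 by exact: bigsetU_measurable.
pose e := expR (- (n%:R / 64)) : R.
have P1 : (P E1 <= e%:E)%E.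
  by apply: (@chi_square_tail _ _ _ P _ X X_gauss X_ind n (fun i => (i, 0%N))) => i j [].
have P2 : (P E2 <= e%:E)%E.
  apply: le_trans (weighted_chi_square_tail X_gauss X_ind c2_inj a_gt0 wa) _.
  rewrite lee_fin ler_expR lerN2 wS invfM mulrA.
  (* By [n / 16 <= S / a] the exponent is at least [n^2 / 64], hence at least [n / 64]. *)
  have n1 : 1 <= n%:R :> R by rewrite ler1n.
  have -> : n%:R * S / 4 / a = n%:R * (S / a) / 4 by field; rewrite gt_eqF.
  nra.
have P4 : (P E4 <= e%:E)%E.
  have := @measure_bigsetU_le_card _ _ _ P _ (enum (l1_grid n (26 * n))) E3 _ mE3
    (fun y => small_image_tail (grid_point y) _).
  move=> /le_trans; apply; rewrite -cardE lee_fin.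
  (* The union bound closes because [137 / 25 - 11 / 2 = - 1 / 50] is below [- 1 / 64]. *)
  apply: (@le_trans _ _ (expR (n%:R * (137 / 25)) * expR (- (11 / 2 * n%:R)))).
    by apply: ler_pM; rewrite ?expR_ge0 ?card_l1_grid_le// ler_expR lerN2.
  by rewrite -expRD ler_expR; lra.
exists (~` (E1 `|` E2 `|` E4)); split.
- by apply: measurableC; apply: measurableU => //; exact: measurableU.
- rewrite probability_setC; last by apply: measurableU => //; exact: measurableU.
  rewrite EFinB leeB// -/e (_ : 3 * e = e + e + e); last by lra.
  rewrite !EFinD; apply: le_trans (measureU2 _ _ _) _ => //; first exact: measurableU.
  apply: leeD => //; apply: le_trans (measureU2 _ _ _) _ => //.
  exact: leeD.
- move=> t /not_orP[/not_orP[t1 t2] t4]; split.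
    by rewrite leNgt; apply/negP => /ltW.
  move=> u; rewrite leNgt; apply/negP => uk.
  have [] := @grid_net R n N (weighted_gaussian t) S kappa n0 S0 k0 _ _.
  + move/negP: t2; rewrite -ltNge wS -(pair_bigA _ (fun i j => s j ^+ 2 * X (i, c j) t ^+ 2))/=.
    rewrite mulrA => /ltW; apply: le_trans.
    rewrite le_eqVlt; apply/orP; left; apply/eqP.
    by apply: eq_bigr => i _; apply: eq_bigr => j _; rewrite mxE exprMn.
  + by exists u.
  + move=> y yg yk; apply: t4; rewrite /E4 -bigcup_seq.
    by exists y => //=; rewrite mem_enum.
Qed.

End GoodEvent.

(** * Kernel vectors and the radius of information *)

Section Radius.
Context {R : realType}.
Implicit Types (x sigma : R^nat).

Lemma normr_le_l2norm x m : (`|x m|%:E <= l2norm x)%E.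
Proof.
rewrite /l2norm Lnorm_counting//.
set s := (\sum_(0 <= _ <oo) _)%E.
have xs : (`|x m|%:E `^ 2 <= s)%E.
  apply: le_trans (nneseries_lim_ge m.+1 _) => [|i _ _]; last exact: poweR_ge0.
  rewrite big_nat_recr//= leeDr// sume_ge0// => i _; exact: poweR_ge0.
have x0 : (0 <= `|x m|%:E)%E by rewrite lee_fin.
have -> : `|x m|%:E = ((`|x m|%:E `^ 2) `^ 2^-1)%E.
  by rewrite -poweRrM mulfV// poweRe1.
have h2 : 0 <= 2^-1 :> R by rewrite invr_ge0.
have p0 := poweR_ge0 `|x m|%:E 2.
by apply: (gt0_ler_poweR h2) (xs); rewrite in_itv/= leey andbT// (le_trans p0 xs).
Qed.

Lemma l2normN x : l2norm (\- x) = l2norm x.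
Proof. by rewrite /l2norm -[RHS]oppe_Lnorm; exact: eq_Lnorm. Qed.

Lemma ellipsoidN sigma x : ellipsoid sigma x -> ellipsoid sigma (\- x).
Proof.
move=> [x2 xs]; split; first by rewrite /ell2/= l2normN.
rewrite /weighted_sqsum; under eq_eseriesr do rewrite EFinN mulNe expe2 muleNN -expe2.
exact: xs.
Qed.

Lemma series_value_opp0 (u : R^nat) : series_value u = Some 0 ->
  series_value (fun j => - u j) = Some 0.
Proof.
rewrite /series_value; case: asboolP => // cu [lu].
have -> : (fun j => - u j) = - u by [].
rewrite is_cvg_seriesN; case: asboolP => // _.
by rewrite lim_seriesN// lu oppr0.
Qed.

Lemma radius1_le_radius n sigma (G : 'I_n -> R^nat) :
  (radius1 sigma G <= radius sigma G)%E.
Proof.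
apply: ge_ereal_sup => _ [x [xE xG] <-].
apply: le_ereal_inf_tmp => _ [phi _ <-].
have NxE := ellipsoidN xE.
have NxG : info G (\- x) = [ffun=> Some 0].
  apply/ffunP => i; move/ffunP/(_ i): (xG); rewrite !ffunE => xi.
  rewrite -[RHS](series_value_opp0 xi); congr series_value.
  by apply/funext => j; rewrite mulrN.
set y := phi [ffun=> Some 0].
(* Both [x] and [- x] are sent to [y]; the sign of [y 0] decides which of them is at distance at
   least [x 0] from it in coordinate 0. *)
have [h|h] := leP (y 0%N) 0.
  apply: ereal_sup_ge; exists (l2norm (phi (info G x) \- x)); first by exists x.
  rewrite xG -/y; apply: le_trans (normr_le_l2norm _ 0%N).
  by rewrite lee_fin/= ler_normr; apply/orP; right; lra.
apply: ereal_sup_ge; exists (l2norm (phi (info G (\- x)) \- (\- x))).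
  by exists (\- x).
rewrite NxG -/y; apply: le_trans (normr_le_l2norm _ 0%N).
by rewrite lee_fin/= ler_normr; apply/orP; left; lra.
Qed.

Lemma finite_nneseries (f : nat -> \bar R) M : (forall m, (0 <= f m)%E) ->
  (forall m, (M <= m)%N -> f m = 0%E) ->
  (\sum_(0 <= m <oo) f m = \sum_(0 <= m < M) f m)%E.
Proof.
move=> f0 fM; rewrite (nneseries_split 0 M)// add0n eseries0 ?adde0// => m mM _.
exact: fM.
Qed.

Lemma finite_ell2 x M : (forall m, (M <= m)%N -> x m = 0) -> ell2 x.
Proof.
move=> xM; rewrite /ell2 /l2norm/= Lnorm_counting// (finite_nneseries (M := M)).
- under eq_bigr do rewrite poweR_EFin.
  by rewrite sumEFin poweR_EFin ltry.
- by move=> m; exact: poweR_ge0.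
- by move=> m /xM /= ->; rewrite normr0 powR0.
Qed.

Lemma finite_series_value (u : R^nat) M : (forall m, (M <= m)%N -> u m = 0) ->
  series_value u = Some (\sum_(0 <= m < M) u m).
Proof.
move=> uM.
have h : \forall m \near \oo, series u m = \sum_(0 <= m < M) u m.
  near=> m; rewrite /series/= (big_cat_nat (n := M))//=; last by near: m; exact: nbhs_infty_ge.
  rewrite (_ : \sum_(M <= i < m) u i = 0) ?addr0//.
  by rewrite big_nat_cond big1// => i /andP[/andP[/uM]].
rewrite /series_value asboolT; last exact: is_cvg_near_cst h.
by congr Some; exact: norm_lim_near_cst.
Unshelve. all: by end_near. Qed.

(* With [x = sigma * q] the weighted quotient is [q], except that it is
   [0 / 0 = 0] where [sigma] vanishes. *)
Lemma finite_ellipsoid sigma (q : R^nat) M : (forall m, (M <= m)%N -> q m = 0) ->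
  \sum_(0 <= m < M) q m ^+ 2 <= 1 -> ellipsoid sigma (fun m => sigma m * q m).
Proof.
move=> qM q1; split.
  by apply: (@finite_ell2 _ M) => m /qM ->; rewrite mulr0.
have qE m : ((((sigma m * q m)%:E / (sigma m)%:E) ^+ 2)%E =
    ((if sigma m == 0 then 0 else q m) ^+ 2)%:E)%E.
  rewrite inver; case: eqVneq => [->|s0]; last by rewrite -EFinM mulrAC divff// mul1r EFin_expe.
  by rewrite mul0r mul0e expe2 mule0 expr0n.
rewrite /weighted_sqsum; under eq_eseriesr do rewrite qE.
rewrite (finite_nneseries (M := M)).
- rewrite sumEFin lee_fin (le_trans _ q1)//; apply: ler_sum => m _.
  by case: ifP => // _; rewrite expr0n sqr_ge0.
- by move=> m; rewrite lee_fin sqr_ge0.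
- by move=> m /qM ->; rewrite if_same expr0n.
Qed.

(** Writing [x = sigma * q] reduces membership in the ellipsoid to [|q| <= 1], even where [sigma]
    vanishes; finite support makes the series of [G] finite sums. *)
Lemma radius1_ge n sigma (G : 'I_n -> R^nat) (q : R^nat) M :
  (forall m, (M <= m)%N -> q m = 0) -> \sum_(0 <= m < M) q m ^+ 2 <= 1 ->
  (forall i, \sum_(0 <= m < M) G i m * (sigma m * q m) = 0) ->
  ((sigma 0%N * q 0%N)%:E <= radius1 sigma G)%E.
Proof.
move=> qM q1 Gq; apply: ereal_sup_ubound; exists (fun m => sigma m * q m) => //.
split; first exact: finite_ellipsoid qM q1.
apply/ffunP => i; rewrite !ffunE (@finite_series_value _ M) ?Gq// => m /qM ->.
by rewrite !mulr0.
Qed.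

End Radius.

(** * The finite window and the choice of constants *)

Section Assembly.
Context {R : realType}.

(** If no partial sum reached [r], the whole series would be at most [r < l]. *)
Lemma nneseries_partial_ge (u : nat -> R) k (r l : R) : (forall j, 0 <= u j) ->
  r < l -> (l%:E <= \sum_(k.+1 <= j <oo) (u j)%:E)%E ->
  exists N, r <= \sum_(j < N) u (k.+1 + j)%N.
Proof.
move=> u0 rl lu; apply: contrapT => h.
have : (\sum_(k.+1 <= j <oo) (u j)%:E <= r%:E)%E.
  apply: lime_le; first by apply: is_cvg_ereal_nneg_natsum => j _; rewrite lee_fin.
  apply: nearW => m; rewrite sumEFin lee_fin leNgt; apply/negP => rm.
  apply: h; exists (m - k.+1)%N; apply: ltW; apply: lt_le_trans rm _.
  rewrite -{1}[k.+1]add0n big_addn big_mkord.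
  by apply: ler_sum => j _; rewrite addnC.
by move=> /(le_trans lu); rewrite lee_fin leNgt rl.
Qed.

Lemma sum_window (F : nat -> R) k N :
  (forall m, (0 < m)%N -> (m <= k)%N -> F m = 0) ->
  \sum_(0 <= m < k.+1 + N) F m = F 0%N + \sum_(j < N) F (k.+1 + j)%N.
Proof.
move=> Fk; rewrite (big_cat_nat (n := k.+1))//= ?leq_addr//; congr (_ + _).
  rewrite big_nat_recl// big_nat_cond big1 ?addr0// => m /andP[/andP[_ mk] _].
  exact: Fk.
rewrite -{1}[k.+1]add0n big_addn addnC addnK big_mkord.
by apply: eq_bigr => j _; rewrite addnC.
Qed.

Lemma radius1_ge_window n (sigma : R^nat) (G : 'I_n -> R^nat) k N (rho kappa beta : R) :
  0 < sigma 0%N -> 0 < kappa ->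
  (forall u, kappa * sqn u <= sqn (u *m
     (\matrix_(i < n, j < N) (sigma (k.+1 + j)%N * G i (k.+1 + j)%N)))) ->
  \sum_i G i 0%N ^+ 2 <= beta ->
  (rho / sigma 0%N) ^+ 2 + rho ^+ 2 * (beta / kappa) <= 1 ->
  (rho%:E <= radius1 sigma G)%E.
Proof.
set A := \matrix_(_, _) _ => s0 k0 kA Gb rb.
have [y yA yb] := solve_min_norm (\row_i G i 0%N) k0 kA.
(* Here [x = sigma * q]. Column 0 contributes [rho] times its entries to the information, and
   [- rho * y] on the window cancels this; the indices from 1 to [k] carry 0. *)
pose q m := if m is 0%N then rho / sigma 0%N else
  if insub (m - k.+1)%N is Some j then
    if (k < m)%N then - rho * y 0 j else 0 else 0.
have q0 : q 0%N = rho / sigma 0%N by [].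
have qw (j : 'I_N) : q (k.+1 + j)%N = - rho * y 0 j.
  rewrite /q addSn -addSn addnC addnK valK.
  by rewrite addnC ltnS leq_addr.
have qk m : (0 < m)%N -> (m <= k)%N -> q m = 0.
  by case: m => // m _ mk; rewrite /q ltnNge mk /=; case: insub.
have qM m : (k.+1 + N <= m)%N -> q m = 0.
  case: m => [|m] mN; first by rewrite addSn in mN.
  by rewrite /q insubF//; lia.
clearbody q.
have -> : rho = sigma 0%N * q 0%N by rewrite q0 mulrC divfK// gt_eqF.
apply: (@radius1_ge _ _ _ _ q (k.+1 + N)) => //.
- rewrite sum_window => [|m m0 mk]; last by rewrite qk// expr0n.
  rewrite q0 (eq_bigr (fun j => rho ^+ 2 * y 0 j ^+ 2)); last first.
    by move=> j _; rewrite qw exprMn sqrrN.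
  rewrite -mulr_sumr -/(sqn y); apply: le_trans rb; rewrite lerD2l.
  rewrite ler_wpM2l ?sqr_ge0//; apply: le_trans yb _.
  rewrite ler_wpM2r ?invr_ge0 ?(ltW k0)//; apply: le_trans Gb.
  by rewrite /sqn; under eq_bigr do rewrite mxE.
- move=> i; rewrite sum_window => [|m m0 mk]; last by rewrite qk// !mulr0.
  have /matrixP/(_ 0 i) := yA; rewrite !mxE => <-.
  rewrite q0 [sigma _ * _]mulrC divfK ?gt_eqF// mulr_suml -big_split/= big1// => j _.
  by rewrite !mxE qw; ring.
Qed.

(** The factor [55 / 29] complements [29 / 10]: their product is the [11 / 2] demanded by
    [good_event]. *)
Lemma constants_bound (eps : R) : 0 < eps < 1 ->
  55 / 29 * eps ^+ 2 <=
  2 - 30 * (15 / 29 * (eps * (1 - eps) ^+ 2 / (2 - eps)) + 3 / 50 ^+ 2).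
Proof.
move=> /andP[e0 e1]; have e2 : 0 < 2 - eps by lra.
rewrite -subr_ge0 -(pmulr_lge0 _ e2).
have -> : (2 - 30 * (15 / 29 * (eps * (1 - eps) ^+ 2 / (2 - eps)) + 3 / 50 ^+ 2) -
   55 / 29 * eps ^+ 2) * (2 - eps) =
  (2 - 90 / 50 ^+ 2 - 55 / 29 * eps ^+ 2) * (2 - eps) - 450 / 29 * (eps * (1 - eps) ^+ 2).
  by field; rewrite gt_eqF.
have t0 : 0 <= 1 - eps by lra.
(* With [t = 1 - eps], the remaining cubic is [395 / 29 * t * (t - 1 / 2) ^+ 2] plus a linear
   polynomial with positive coefficients. *)
have := mulr_ge0 t0 (sqr_ge0 (1 - eps - 1 / 2)); nra.
Qed.

End Assembly.

Theorem theorem5 (R : realType) (d : measure_display) (T : measurableType d)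
    (P : probability T R) (sigma : nat -> R) (eps : R) (n k : nat)
    (g : 'I_n -> nat -> {RV P >-> R})
    (sigma_ell2 : ell2 sigma)
    (sigma_ge0 : forall j : nat, 0 <= sigma j)
    (sigma_noninc : nonincreasing_seq sigma)
    (eps_bounds : 0 < eps < 1)
    (n_gt0 : (0 < n)%N)
    (g_gauss : gaussian_matrix g)
    (tail_ge : ((3 * n%:R * sigma k ^+ 2 / eps ^+ 2)%:E <=
                \sum_(k.+1 <= j <oo) (sigma j ^+ 2)%:E)%E) :
  exists A : set T,
    [/\ measurable A,
        ((1 - 5 * expR (- (n%:R / 64)))%:E <= P A)%E &
        forall t : T, A t ->
          (radius1 sigma (fun i j => g i j t) <=
             radius sigma (fun i j => g i j t))%E /\
          ((sigma k * (1 - eps))%:E <=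
             radius1 sigma (fun i j => g i j t))%E].
Proof.
have /andP[e0 e1] := eps_bounds.
have n0 : 0 < n%:R :> R by rewrite ltr0n.
(* If [sigma k] vanishes, the zero vector is a witness for every outcome. *)
have [sk0|sk0] := eqVneq (sigma k) 0.
  exists setT; split => // [|t _].
    by rewrite probability_setT lee_fin gerBl mulr_ge0// expR_ge0.
  split; first exact: radius1_le_radius.
  rewrite sk0 mul0r -(mulr0 (sigma 0%N)).
  apply: (@radius1_ge _ _ _ _ (fun=> 0) 0%N) => //.
    by rewrite big_geq.
  by move=> i; rewrite big_geq.
have skp : 0 < sigma k by rewrite lt_neqAle eq_sym sk0 sigma_ge0.
pose a := sigma k ^+ 2; have a0 : 0 < a by rewrite exprn_gt0.
have nae : 0 < n%:R * a / eps ^+ 2 by rewrite divr_gt0 ?exprn_gt0 ?mulr_gt0.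
(* Lowering 3 to [29 / 10] leaves the strict gap that lets a finite window replace the tail. *)
have [N SN] := @nneseries_partial_ge R (fun j => sigma j ^+ 2) k
  (29 / 10 * (n%:R * a / eps ^+ 2)) (3 * n%:R * sigma k ^+ 2 / eps ^+ 2)
  (fun j => sqr_ge0 _) ltac:(rewrite -/a; lra) tail_ge.
set S := \sum_(j < N) _ in SN.
(* Chosen so that [eps * (2 - eps) * kappa * S] is at least [3 / 2 * n * a * (1 - eps) ^+ 2] when
   [S] attains its lower bound. *)
pose kappa := 15 / 29 * (eps * (1 - eps) ^+ 2 / (2 - eps)).
have kappa0 : 0 < kappa.
  apply: mulr_gt0; first by lra.
  by apply: divr_gt0; [apply: mulr_gt0 => //; apply: exprn_gt0|]; lra.
have S0 : 0 < S by apply: lt_le_trans SN; lra.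
have Sa : 29 / 10 * (n%:R / eps ^+ 2) <= S / a.
  by rewrite ler_pdivlMr//; apply: le_trans SN; lra.
have ne : n%:R <= n%:R / eps ^+ 2.
  by rewrite ler_pdivlMr ?exprn_gt0// ler_piMr ?(ltW n0)// expr_le1// ltW.
have [g_std g_ind] := g_gauss.
have c_inj : injective (fun j : 'I_N => (k.+1 + j)%N).
  by move=> i j /addnI /val_inj.
have s_le (j : 'I_N) : sigma (k.+1 + j)%N ^+ 2 <= a.
  by rewrite lerXn2r ?nnegrE// sigma_noninc// addSn ltnW// ltnS leq_addr.
have [|||E [mE PE EG]] := @good_event d T R P n (fun p => g p.1 p.2)
  (fun p => g_std p.1 p.2) g_ind N _ _ a c_inj a0 s_le kappa n_gt0.
- exact: ltW.
- by rewrite -/S; lra.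
- rewrite -/S; have := constants_bound eps_bounds; rewrite -/kappa => cb.
  apply: (@le_trans _ _ (29 / 10 * (n%:R / eps ^+ 2) * (55 / 29 * eps ^+ 2))).
    by rewrite le_eqVlt; apply/orP; left; apply/eqP; field; rewrite gt_eqF.
  apply: ler_pM => //; first by rewrite mulr_ge0// ?divr_ge0 ?sqr_ge0 ?(ltW n0)//; lra.
  by rewrite mulr_ge0 ?sqr_ge0//; lra.
- exists E; split => //.
    apply: le_trans PE; rewrite lee_fin lerB// ler_wpM2r ?expR_ge0//; lra.
  move=> t /EG[tb tk]; split; first exact: radius1_le_radius.
  have s0k : sigma k <= sigma 0%N by exact: sigma_noninc.
  have s0p : 0 < sigma 0%N := lt_le_trans skp s0k.
  apply: (@radius1_ge_window _ _ _ _ k N _ (kappa * S) (3 / 2 * n%:R)) => //; first by rewrite mulr_gt0.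
  (* The two budgets sum to 1: coordinate 0 takes at most [(1 - eps) ^+ 2], since
     [sigma k <= sigma 0], and the window takes at most the rest. *)
  apply: (@le_trans _ _ ((1 - eps) ^+ 2 + eps * (2 - eps))); last by nra.
  apply: lerD.
    rewrite lerXn2r ?nnegrE ?divr_ge0 ?mulr_ge0 ?(ltW skp) ?(ltW s0p) ?subr_ge0 ?(ltW e1)//.
    by rewrite ler_pdivrMr// mulrC ler_wpM2l// subr_ge0 ltW.
  rewrite exprMn -/a (mulrA (a * _)) ler_pdivrMr ?(mulr_gt0 kappa0 S0)//.
  have -> : eps * (2 - eps) * (kappa * S) = 15 / 29 * eps ^+ 2 * (1 - eps) ^+ 2 * S.
    by rewrite /kappa; field; rewrite gt_eqF//; lra.
  have -> : a * (1 - eps) ^+ 2 * (3 / 2 * n%:R) =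
    15 / 29 * eps ^+ 2 * (1 - eps) ^+ 2 * (29 / 10 * (n%:R * a / eps ^+ 2)).
    by field; rewrite gt_eqF.
  rewrite ler_wpM2l// !mulr_ge0 ?sqr_ge0//; lra.
Qed.
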